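(* Let $\mathcal{C}_2(4)=\{x\in\{1,2,3,4\}^{\mathbb{Z}^2}: x(p)\ne x(p+e_i)\text{ for all }p\in\mathbb{Z}^2,\ i=1,2\}$, and let $\mu$ be a Markov random field on $\{1,2,3,4\}^{\mathbb{Z}^2}$ such that $\operatorname{supp}(\mu)=\mathcal{C}_2(4)$. Then $\mu$ does not satisfy strong spatial mixing (with any rate).
   Context: $e_1,e_2$ is the canonical basis of $\mathbb{Z}^2$. $\|p\|=\sum_i|p_i|$; $\operatorname{dist}(A,B)=\min_{p\in A,q\in B}\|p-q\|$ ($\infty$ if one set is empty); $\partial S=\{p\notin S:\operatorname{dist}(\{p\},S)=1\}$. With $\mathcal{A}=\{1,2,3,4\}$, a configuration on $S\subseteq\mathbb{Z}^2$ is $u\in\mathcal{A}^S$, $x(S)$ denotes restriction, and $\mu(u)$ is the measure of $\{x:x(S)=u\}$. $\operatorname{supp}(\mu)=\{x:\mu(x(S))>0\ \forall\text{ finite }S\}$. Markov random field (MRF): a shift-invariant Borel probability measure $\mu$ such that for every finite $S$, $u\in\mathcal{A}^S$, finite $T$ with $\partial S\subseteq T\subseteq\mathbb{Z}^2\setminus S$, $\delta\in\mathcal{A}^T$ with $\mu(\delta)>0$: $\mu(u\mid\delta)=\mu(u\mid\delta(\partial S))$. Write $\mu^\delta=\mu(\cdot\mid\delta)$. Strong spatial mixing: $\mu$ satisfies strong spatial mixing if there is $f:\mathbb{N}\to\mathbb{R}_{\ge0}$ with $f(n)\to0$ (and $f(\infty)=0$) such that for every finite $W\subset\mathbb{Z}^2$,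 $U\subseteq W$, $u\in\mathcal{A}^U$, $\delta_1,\delta_2\in\mathcal{A}^{\partial W}$ with $\mu(\delta_1),\mu(\delta_2)>0$: $|\mu^{\delta_1}(u)-\mu^{\delta_2}(u)|\le|U|f(\operatorname{dist}(U,\Sigma))$, where $\Sigma=\{p\in\partial W:\delta_1(p)\ne\delta_2(p)\}$. *)

(* Defs.v *)
From HB Require Import structures.
From mathcomp Require Import all_boot all_order all_algebra finmap.
From mathcomp Require Import all_classical all_reals all_analysis.

Set Implicit Arguments.
Unset Strict Implicit.
Unset Printing Implicit Defensive.
Import Order.TTheory GRing.Theory Num.Theory.
Import numFieldNormedType.Exports.
Local Open Scope classical_set_scope.
Local Open Scope ring_scope.

Definition Z2 : zmodType := (int * int)%type.

Definition e1 : Z2 := (1, 0).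
Definition e2 : Z2 := (0, 1).

Definition norm1 (p : Z2) : nat := (`|p.1| + `|p.2|)%N.

Definition at_dist (A B : set Z2) (n : nat) : bool :=
  `[< exists p q : Z2, [/\ A p, B q & norm1 (p - q) = n] >].

(* [None] stands for the distance +oo. *)
Definition set_dist (A B : set Z2) : option nat :=
  if pselect (exists n, at_dist A B n) is left exAB
  then Some (ex_minn exAB) else None.

Definition boundary (S : set Z2) : set Z2 :=
  [set p | ~ S p /\ set_dist [set p] S = Some 1%N].

(* The letters 1, 2, 3, 4 are the elements of 'I_4; the measurable structure
   below asks for a pointed type, and the choice of point is immaterial. *)
HB.instance Definition _ := isPointed.Build 'I_4 ord0.

Definition conf : Type := prod_topology (fun _ : Z2 => discrete_topology 'I_4).

(* conf with the Borel sigma-algebra of the product topology. *)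
Definition borel_conf : measurableType (sigma_display (@open conf)) :=
  g_sigma_algebraType (@open conf).

(* A configuration on S is given by any total extension u : conf of it;
   every notion below depends on u only through its values on the set S it is
   paired with. *)
Definition cylinder (S : set Z2) (u : conf) : set borel_conf :=
  [set x : conf | forall p, S p -> x p = u p].

Definition shift_conf (a : Z2) (x : conf) : conf := fun p => x (p + a).

Section RandomFields.
Context {R : realType}.
Implicit Type mu : probability borel_conf R.

Definition supp mu : set conf :=
  [set x | forall S : set Z2, finite_set S -> (0 < mu (cylinder S x))%E].

(* mu (A | B), only used when mu B > 0. *)
Definition cond_prob mu (A B : set borel_conf) : R :=
  fine (mu (A `&` B)) / fine (mu B).

Definition shift_invariant mu : Prop :=
  forall (a : Z2) (B : set borel_conf),
    measurable B -> mu (shift_conf a @^-1` B) = mu B.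

Definition markov_random_field mu : Prop :=
  shift_invariant mu /\
  forall (S T : set Z2) (u delta : conf),
    finite_set S -> finite_set T ->
    boundary S `<=` T -> T `<=` ~` S ->
    (0 < mu (cylinder T delta))%E ->
    cond_prob mu (cylinder S u) (cylinder T delta) =
    cond_prob mu (cylinder S u) (cylinder (boundary S) delta).

(* The rate f, extended by f(+oo) = 0. *)
Definition rate_at (f : nat -> R) (d : option nat) : R :=
  if d is Some n then f n else 0.

Definition disagreement (W : set Z2) (delta1 delta2 : conf) : set Z2 :=
  [set p | boundary W p /\ delta1 p <> delta2 p].

Definition ssm_with_rate mu (f : nat -> R) : Prop :=
  forall (W U : set Z2) (u delta1 delta2 : conf),
    finite_set W -> U `<=` W ->
    (0 < mu (cylinder (boundary W) delta1))%E ->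
    (0 < mu (cylinder (boundary W) delta2))%E ->
    `|cond_prob mu (cylinder U u) (cylinder (boundary W) delta1) -
      cond_prob mu (cylinder U u) (cylinder (boundary W) delta2)|
    <= #|` fset_set U|%:R * rate_at f (set_dist U (disagreement W delta1 delta2)).

Definition strong_spatial_mixing mu : Prop :=
  exists f : nat -> R,
    [/\ forall n, 0 <= f n, f @ \oo --> 0 & ssm_with_rate mu f].

End RandomFields.

Definition proper4 : set conf :=
  [set x | forall p : Z2, x p <> x (p + e1) /\ x p <> x (p + e2)].

(* Main.v *)
(** A positive-probability boundary condition can force a whole row. Let W be
    the horizontal segment of half-length n, and give the sites just above and
    just below it the two letters 2 and 3, one on each side. A proper
    configuration must then alternate 0 and 1 on W, in the phase prescribed by
    either endpoint. The two phases give boundary conditions that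
    differ only at the two endpoints, at distance n + 1 from the origin, yet
    under them the letter at the origin is deterministic and different. Hence
    any rate f satisfies 1 <= f (n + 1) for all n. *)

Require Import Defs.
From HB Require Import structures.
From mathcomp Require Import all_boot all_order all_algebra finmap zify.
From mathcomp Require Import all_classical all_reals all_analysis.

Set Implicit Arguments.
Unset Strict Implicit.
Unset Printing Implicit Defensive.
Import Order.TTheory GRing.Theory Num.Theory.
Import numFieldNormedType.Exports.
Local Open Scope classical_set_scope.
Local Open Scope ring_scope.

Lemma measurable_cylinder (S : set Z2) (u : conf) :
  finite_set S -> measurable (cylinder S u).
Proof.
move=> finS.
have -> : cylinder S u =
    \bigcap_(p in S) [set x : borel_conf | (x : conf) p = u p].
  by apply/seteqP; split.
apply: fin_bigcap_measurable => // p _; apply: sub_sigma_algebra.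
have projc : continuous (fun x : conf => (x p : discrete_topology 'I_4)).
  exact: (@proj_continuous _ (fun _ : Z2 => discrete_topology 'I_4) p).
apply: (proj1 (continuousP _) projc [set u p]).
exact: discrete_open.
Qed.

(* The complement of the support is the union of the null cylinders over
   finite sets, of which there are countably many. *)
Lemma negligible_setC_supp (R : realType) (mu : probability borel_conf R) :
  mu.-negligible (~` supp mu).
Proof.
(* Finite lists of site-letter pairs form a countable type, so decoding [k] enumerates every
   cylinder over a finite set; [N k] keeps only the null ones. *)
pose cyl (l : seq (Z2 * 'I_4)) : set borel_conf :=
  [set x : conf | all (fun pc => x pc.1 == pc.2) l].
pose N k : set borel_conf :=
  if choice.unpickle k is Some l then
    if mu (cyl l) == 0%E then cyl l else set0 else set0.
have cylE (s : seq Z2) (u : conf) :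
    cylinder [set` s] u = cyl [seq (p, u p) | p <- s].
  apply/seteqP; split=> x /=.
    by move=> xu; apply/allP => _ /mapP[p ps ->] /=; rewrite xu.
  by move=> /allP xu p ps; apply/eqP/(xu (p, u p))/map_f.
have finN k : mu.-negligible (N k).
  rewrite /N; case: choice.unpickle => [l|]; last exact: negligible_set0.
  case: eqP => [cyl0|_]; last exact: negligible_set0.
  apply/negligibleP => //.
  (* A list may give one site two letters, so [cyl l] need not be a cylinder; it is still an
     intersection of one-site cylinders. *)
  rewrite (_ : cyl l = \bigcap_(pc in [set` l])
      cylinder [set pc.1] (fun _ => pc.2)).
    by apply: fin_bigcap_measurable => // pc _; exact: measurable_cylinder.
  apply/seteqP; split=> x /=.
    by move=> /allP xl pc /xl /eqP xpc _ ->.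
  by move=> xl; apply/allP => pc pcl; apply/eqP/(xl pc).
apply: negligibleS (negligible_bigcup finN) => x /= /existsNP[S].
move=> /not_implyP[/finite_seqP[s ->]] /negP; rewrite lt0e measure_ge0 andbT.
move/negPn => mu0; exists (choice.pickle [seq (p, x p) | p <- s]) => //.
by rewrite /N choice.pickleK -cylE mu0.
Qed.

Lemma set_dist_attained (A B : set Z2) (n : nat) :
  set_dist A B = Some n -> exists p q, [/\ A p, B q & norm1 (p - q) = n].
Proof.
rewrite /set_dist; case: pselect => // exAB [<-].
by case: ex_minnP => m /asboolP.
Qed.

Lemma boundaryP (S : set Z2) (p : Z2) :
  boundary S p <-> ~ S p /\ exists2 q, S q & norm1 (p - q) = 1%N.
Proof.
split=> [[Sp /set_dist_attained[_ [q [-> Sq pq1]]]]|[Sp [q Sq pq1]]].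
  by split=> //; exists q.
split=> //; rewrite /set_dist; case: pselect => [exAB|[]]; last first.
  by exists 1%N; apply/asboolP; exists p, q.
(* The minimum is at most 1, and 0 would put [p] in [S]. *)
congr Some; case: ex_minnP => m /asboolP[_ [r [-> Sr pr]]] /(_ 1%N).
have {}/[swap] /[apply] : at_dist [set p] S 1 by apply/asboolP; exists p, q.
case: m pr => [|[]]// pr _; case: Sp.
suff -> : p = r by [].
apply/eqP; rewrite -subr_eq0.
by move: pr; rewrite /norm1; case: (p - r) => a b /=; rewrite xpair_eqE; lia.
Qed.

Lemma finite_box (N : nat) :
  finite_set [set p : Z2 | (`|p.1| <= N)%N /\ (`|p.2| <= N)%N].
Proof.
have fin2 := finite_setX (finite_II N.*2.+1) (finite_II N.*2.+1).
apply: sub_finite_set (finite_image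
  (fun ab : nat * nat => (ab.1%:Z - N%:Z, ab.2%:Z - N%:Z) : Z2) fin2).
move=> [a b] /= [aN bN]; exists (absz (a + N%:Z), absz (b + N%:Z)) => /=.
  by split; lia.
by congr pair => /=; lia.
Qed.

Lemma finite_boundary (S : set Z2) (N : nat) :
  S `<=` [set p : Z2 | (`|p.1| <= N)%N /\ (`|p.2| <= N)%N] ->
  finite_set (boundary S).
Proof.
move=> SN; apply: sub_finite_set (finite_box N.+1) => p.
move=> /boundaryP[_ [q /SN /= [q1 q2]]].
by case: p q q1 q2 => [a b] [c d] /=; rewrite /norm1 /=; lia.
Qed.

Definition segment (n : nat) : set Z2 :=
  [set p | p.2 = 0 /\ (`|p.1| <= n)%N].

Lemma finite_boundary_segment (n : nat) : finite_set (boundary (segment n)).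
Proof. by apply: (@finite_boundary _ n) => p [/= -> ->]. Qed.

(* The rows 1 and -1 are in opposite phase, so that each site of the segment
   sees both letters 2 and 3, whatever the phase s of row 0. *)
Definition two_phase (s : bool) : conf := fun p =>
  if p.2 == 0 then inord (odd `|p.1|%N (+) s)
  else inord (2 + (odd `|p.1|%N (+) odd `|p.2|%N (+) (p.2 < 0))).

Lemma val_two_phase (s : bool) (p : Z2) :
  two_phase s p = (if p.2 == 0 then nat_of_bool (odd `|p.1|%N (+) s)
  else (2 + (odd `|p.1| (+) odd `|p.2| (+) (p.2 < 0)%R))%N) :> nat.
Proof.
by rewrite /two_phase; case: ifP => _; rewrite inordK //; case: (_ (+) _).
Qed.

Lemma odd_absz_addr1 (i : int) : odd (absz (i + 1)) = ~~ odd `|i|%N.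
Proof. by case: i => i; lia. Qed.

(** A horizontal step flips a parity. A vertical step either touches row 0, where the letters 0, 1
    meet 2, 3, or keeps the sign of the second coordinate and flips its parity. *)
Lemma two_phase_proper (s : bool) : proper4 (two_phase s).
Proof.
move=> [i j]; split=> /(congr1 val) /=; rewrite !val_two_phase /= !addr0.
  by rewrite odd_absz_addr1; case: eqP => _; case: (odd (absz i)); case: s;
    case: (odd (absz j)); case: (j < 0).
rewrite odd_absz_addr1; have [->|j0] := eqVneq j 0.
  by case: (_ (+) s); case: (_ (+) _).
have [_|j1] := eqVneq (j + 1) 0; first by case: (_ (+) s); case: (_ (+) _).
have -> : (j + 1 < 0) = (j < 0) by lia.
by case: (odd (absz i)); case: (odd (absz j)); case: (j < 0).
Qed.

Lemma two_phase_row0_lt2 (s : bool) (i : int) : (two_phase s (i, 0%R) < 2)%N.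
Proof. by rewrite val_two_phase /=; case: (_ (+) _). Qed.

Lemma two_phase_forced (n : nat) (s : bool) (x : conf) :
  proper4 x -> (forall p, boundary (segment n) p -> x p = two_phase s p) ->
  x (0 : Z2) = two_phase s (0 : Z2).
Proof.
move=> px xs.
have row0 (i : int) : (`|i| <= n)%N -> (x (i, 0%R) < 2)%N.
  move=> iN.
  have side (j : int) : `|j|%N = 1%N -> x (i, j) = two_phase s (i, j).
    move=> j1; apply: xs; apply/boundaryP; split; first by case=> /=; lia.
    by exists (i, 0) => //=; rewrite /norm1 /=; lia.
  have /= [_] := px (i, 0); have /= [_] := px (i, -1).
  rewrite [(i, -1) + _](_ : _ = (i, 0)); last by congr pair => /=; lia.
  rewrite [(i, 0) + _](_ : _ = (i, 1)); last by congr pair => /=; lia.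
  rewrite (side 1) // (side (-1)) // => /eqP + /eqP.
  rewrite -!val_eqE /= !val_two_phase /=.
  by case: (odd (absz i)); case: (x (i, 0)) => [[|[|[|[|]]]]].
(* Induction along row 0 from the left boundary site, at abscissa [- n.+1], to the origin, reached
   at [k = n.+1]. *)
suff H (k : nat) : (k <= n.+1)%N ->
    x (k%:Z - n.+1%:Z, 0) = two_phase s (k%:Z - n.+1%:Z, 0).
  by have := H n.+1 (leqnn _); rewrite subrr.
elim: k => [_|k IHk kn].
  rewrite sub0r; apply: xs; apply/boundaryP; split; first by case=> /=; lia.
  by exists (- n%:Z, 0) => /=; [split=> //=; lia | rewrite /norm1 /=; lia].
(* At the next site [x] and [two_phase s] both avoid the same previous letter and both lie in {0,
   1}, hence they agree. *)
have [+ _] := px (k%:Z - n.+1%:Z, 0).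
have := two_phase_proper s (k%:Z - n.+1%:Z, 0) => -[+ _].
rewrite [_ + e1](_ : _ = (k.+1%:Z - n.+1%:Z, 0)); last by congr pair => /=; lia.
have := row0 (k.+1%:Z - n.+1%:Z).
rewrite IHk ?(ltnW kn)//; move=> /(_ ltac:(lia)).
have := two_phase_row0_lt2 s (k.+1%:Z - n.+1%:Z).
have := two_phase_row0_lt2 s (k%:Z - n.+1%:Z).
move: (two_phase s _) (two_phase s _) (x _).
move=> [a ?] [b ?] [c ?] /= ? ? ? /eqP + /eqP; rewrite -!val_eqE /= => ? ?.
by apply: val_inj => /=; lia.
Qed.

(** The measure is carried by proper configurations. By [two_phase_forced] none of them lies in [B]
    minus [A] when the phases agree, nor in the intersection of [A] and [B] when they differ. *)
Lemma cond_prob_two_phase (R : realType) (mu : probability borel_conf R)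
    (n : nat) (s t : bool) :
  supp mu = proper4 ->
  cond_prob mu (cylinder [set 0] (two_phase t))
    (cylinder (boundary (segment n)) (two_phase s)) = (t == s)%:R.
Proof.
move=> mu_supp; have fin_bd := finite_boundary_segment n.
rewrite /cond_prob; set A := cylinder [set 0] _; set B := cylinder _ _.
have mA : measurable A by exact: measurable_cylinder.
have mB : measurable B by exact: measurable_cylinder.
have B_gt0 : (0 < mu B)%E.
  have : supp mu (two_phase s) by rewrite mu_supp; exact: two_phase_proper.
  exact.
have fineB_neq0 : fine (mu B) != 0.
  by rewrite gt_eqF// fine_gt0// B_gt0 ltey_eq fin_num_measure.
have null (C : set borel_conf) :
    measurable C -> C `<=` ~` (proper4 : set borel_conf) -> mu C = 0%E.
  move=> mC Cimproper; apply: measure_negligible => //.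
  by apply: negligibleS (negligible_setC_supp mu); rewrite mu_supp.
have [ts|ts] := eqVneq t s.
  have BDA0 : mu (B `\` A) = 0%E.
    apply: null; first exact: measurableD.
    move=> x [Bx nAx] px; apply: nAx => _ ->; rewrite ts.
    exact: two_phase_forced px Bx.
  by rewrite setIC -[mu (B `&` A)]add0e -BDA0 -measureDI// divff.
rewrite null ?mul0r//; first exact: measurableI.
move=> x [Ax Bx] px; have := two_phase_forced px Bx.
rewrite (Ax 0 erefl) => /(congr1 val) /=; rewrite !val_two_phase /=.
by case: t s ts {A B mA mB B_gt0 fineB_neq0 Ax Bx fin_bd} => [] [].
Qed.

Theorem proposition6p6 (R : realType) (mu : probability borel_conf R)
    (mu_mrf : markov_random_field mu) (mu_supp : supp mu = proper4) :
  ~ strong_spatial_mixing mu.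
Proof.
move=> [f [_ f0 ssm]].
(* From [N] on the rate is below 1, so [N] serves as the half-length of the segment. *)
have [N _ fN] := cvgr_lt 0 f0 1 ltr01.
have pos s : (0 < mu (cylinder (boundary (segment N)) (two_phase s)))%E.
  have : supp mu (two_phase s) by rewrite mu_supp; exact: two_phase_proper.
  by apply; exact: finite_boundary_segment.
have fin_seg : finite_set (segment N).
  by apply: sub_finite_set (finite_box N) => p [/= -> ->].
have sub0 : [set 0] `<=` segment N by move=> _ ->.
have := ssm _ _ (two_phase false) _ _ fin_seg sub0 (pos false) (pos true).
rewrite !cond_prob_two_phase// subr0 normr1 fset_set1 cardfs1 mul1r.
(* An infinite distance has rate 0, which already contradicts the lower bound 1. *)
rewrite /rate_at; case E: set_dist => [m|]; last by rewrite ler10.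
apply/negP; rewrite -ltNge; apply: fN => /=.
have [_ [q [-> [/boundaryP[nseg _] neq] <-]]] := set_dist_attained E.
(* Off row 0 the phase is irrelevant, so a disagreement lies on row 0 outside the segment, farther
   than [N] from the origin. *)
have q2 : q.2 = 0.
  apply: contra_notP neq => /eqP/negPf q2; apply: val_inj.
  by rewrite /= !val_two_phase q2.
rewrite /norm1 /= q2; apply: contra_notT nseg; rewrite /segment /=.
by split=> //; lia.
Qed.
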